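(* Let $n=2m>3$ be an even integer and let $a,b$ be natural numbers with $1\le a<b\le n-1$. If $a$ and $b$ are both odd and $\gcd(a+b,n)=2$, then $a$ and $b$ always induce an $n$-polygon with $m$ axes, i.e. the $n$-tuple of sides $(a,b,a,b,\ldots,a,b)$ represents an $n$-polygon with $m$ axes.
   Context: Fix the vertices $v_k=e^{2\pi i k/n}$, $k=0,\ldots,n-1$, on the unit circle. An $n$-polygon is a Hamiltonian cycle through these vertices: a closed path $v_{\sigma_1}\cdots v_{\sigma_n}v_{\sigma_1}$ of straight segments with $(\sigma_1,\ldots,\sigma_n)$ an ordering of $0,\ldots,n-1$. Its sides are the integers $e_i\in\{1,\ldots,n-1\}$ with $e_i\equiv\sigma_{i+1}-\sigma_i\pmod n$; an $n$-tuple of sides represents a polygon if starting at a vertex and moving counterclockwise successively by the sides visits each vertex exactly once before returning to the start after the $n$-th step. An $n$-polygon with $m$ axes is one with exactly $m$ axes of reflection symmetry. *)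

(* Defs.v *)
(* The plane is R[i], for an arbitrary realType R. *)
From HB Require Import structures.
From mathcomp Require Import all_boot all_order all_algebra all_fingroup.
From mathcomp Require Import all_classical reals trigo.
From mathcomp Require Import complex.

Set Implicit Arguments.
Unset Strict Implicit.
Unset Printing Implicit Defensive.

Import Order.TTheory GRing.Theory Num.Theory.

Local Open Scope classical_set_scope.
Local Open Scope ring_scope.
Local Open Scope complex_scope.

Section Plane.
Variable R : realType.
Implicit Types (p d z w : R[i]) (L : set R[i]).

Definition segment z w : set R[i] :=
  [set (1 - t)%:C * z + t%:C * w | t in [set t : R | 0 <= t <= 1]].

Definition line p d : set R[i] := [set p + t%:C * d | t in [set: R]].

(* Reflection in the line through p with direction d != 0: if d has argument
   theta, then d / d^* = exp(2 i theta). *)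
Definition reflection p d z : R[i] := p + d / Num.conj d * Num.conj (z - p).

Definition vertex (n k : nat) : R[i] :=
  let t := 2 * pi * k%:R / n%:R in cos t +i* sin t.

(* A polygon is given by an ordering s of the n vertices; all notions below
   depend only on the cycle, not on its starting point or orientation.
   Indices are cyclic: ordS i is i + 1 modulo n. *)
Definition polygon_segments n (s : 'S_n) : set (set R[i]) :=
  range (fun i : 'I_n => segment (vertex n (s i)) (vertex n (s (ordS i)))).

(* Axes are arbitrary lines of the plane, not assumed to contain the centre. *)
Definition polygon_axes n (s : 'S_n) : set (set R[i]) :=
  [set L | exists p d, [/\ d != 0, L = line p d &
    [set reflection p d @` S | S in polygon_segments s] = polygon_segments s]].

Definition polygon_with_axes n (s : 'S_n) (m : nat) : Prop :=
  (polygon_axes s #= `I_m)%card.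

End Plane.

(* Starting at the vertex s 0, the moves e_0, ..., e_(n-1) visit s 0, s 1, ...
   in order, and the last one returns to s 0; as s is a permutation, every
   vertex is visited exactly once. *)
Definition represents n (e : n.-tuple nat) (s : 'S_n) : Prop :=
  (forall i : 'I_n, (1 <= tnth e i <= n.-1)%N) /\
  (forall i : 'I_n, s i + tnth e i = s (ordS i) %[mod n])%N.

Definition alternating_sides n (a b : nat) : n.-tuple nat :=
  [tuple if odd i then b else a | i < n].

(* Main.v *)
(** Consecutive vertices of the polygon have opposite parities, and its sides
    are exactly the segments {x, x + a} and {x, x - b} with x in one fixed parity
    class.  A symmetry axis permutes the endpoints of the sides; since these
    include two antipodal vertices, it passes through the centre, so that the
    reflection is v_x |-> v_(t - x) for some t.  If t is odd, the two parity
    classes are exchanged and every side is mapped to a side of the same length.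
    If t is even, the classes are preserved while the direction is reversed, so
    that a = b, or 2a = 2b = 0, modulo n; both are impossible.  The axes thus
    correspond to the m odd residues t. *)
Require Import Defs.
From mathcomp Require Import all_boot all_order all_algebra all_fingroup.
From mathcomp Require Import all_classical reals trigo complex.
From mathcomp Require Import ring lra zify.

Set Implicit Arguments.
Unset Strict Implicit.
Unset Printing Implicit Defensive.

Import Order.TTheory GRing.Theory Num.Theory.

Local Open Scope classical_set_scope.
Local Open Scope ring_scope.
Local Open Scope complex_scope.

(** * Roots of unity indexed by residues modulo [n] *)

Section Vertices.
Variable R : realType.

Lemma conjCE (z : R[i]) : Num.conj z = conjc z.
Proof. by case: z. Qed.

Lemma conj_realC (t : R) : Num.conj t%:C = t%:C.
Proof. by rewrite conjCE conjc_real. Qed.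

Lemma conj_fixed_real (z : R[i]) : Num.conj z = z -> exists t : R, z = t%:C.
Proof.
case: z => x y; rewrite conjCE => -[/eqP].
rewrite -subr_eq0 -opprD oppr_eq0 -mulr2n mulrn_eq0 /= => /eqP ->.
by exists x.
Qed.

Lemma vertexD n i j : vertex R n (i + j) = vertex R n i * vertex R n j.
Proof.
rewrite /vertex natrD mulrDr mulrDl cosD sinD.
by apply/eqP; rewrite eq_complex /= eqxx /= [X in _ == X]addrC.
Qed.

Lemma vertex0 n : vertex R n 0 = 1.
Proof. by rewrite /vertex mulr0 mul0r cos0 sin0. Qed.

Lemma vertex_unit n k : vertex R n k * Num.conj (vertex R n k) = 1.
Proof.
rewrite conjCE /vertex; set t := (X in cos X).
apply/eqP; rewrite eq_complex /= mulrN opprK -!expr2 cos2Dsin2 eqxx /=.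
by rewrite [X in _ + X]mulrC mulrN addNr.
Qed.

Lemma vertex_neq0 n k : vertex R n k != 0.
Proof.
by apply: contra_eq_neq (vertex_unit n k) => ->; rewrite mul0r eq_sym oner_eq0.
Qed.

Lemma conj_vertex n k : Num.conj (vertex R n k) = (vertex R n k)^-1.
Proof.
by apply: (mulfI (vertex_neq0 n k)); rewrite vertex_unit mulfV ?vertex_neq0.
Qed.

Lemma vertex_full n : (0 < n)%N -> vertex R n n = 1.
Proof.
move=> n0; rewrite /vertex mulfK ?pnatr_eq0 -?lt0n //.
by rewrite mulrC mulr_natr cos2pi sin2pi.
Qed.

Lemma vertex_half m : (0 < m)%N -> vertex R (2 * m) m = -1.
Proof.
move=> m0; have -> : vertex R (2 * m) m = cos pi +i* sin pi.
  rewrite /vertex natrM; suff -> : 2 * pi * m%:R / (2 * m%:R) = pi :> R by [].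
  by field; rewrite pnatr_eq0 -lt0n.
by rewrite cospi sinpi; apply/eqP; rewrite eq_complex /= oppr0 !eqxx.
Qed.

Lemma vertex_double n k :
  vertex R (2 * n) k * vertex R (2 * n) k = vertex R n k.
Proof.
rewrite -vertexD /vertex addnn -mul2n !natrM.
suff -> : 2 * pi * (2 * k%:R) / (2 * n%:R) = 2 * pi * k%:R / n%:R :> R by [].
by rewrite [_ * (2 * _)]mulrCA -mulf_div divff ?pnatr_eq0// mul1r.
Qed.

(** The angle is [2 * t] with [t = pi * (k / n)] strictly between 0 and [pi]; hence [sin t > 0] and
    the real part [cos t ^ 2 - sin t ^ 2] is less than 1. *)
Lemma vertex_neq1 n k : (0 < k < n)%N -> vertex R n k != 1.
Proof.
case/andP=> k0 kn; rewrite -vertex_double.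
have n0 : (0 < n)%N by exact: leq_ltn_trans kn.
have E : 2 * pi * k%:R / (2 * n)%N%:R = pi * (k%:R / n%:R) :> R.
  by rewrite natrM; field; rewrite pnatr_eq0 -lt0n.
have s0 : 0 < sin (pi * (k%:R / n%:R) : R).
  apply: sin_gt0_pi; rewrite mulr_gt0 ?pi_gt0 ?divr_gt0 ?ltr0n//=.
  by rewrite gtr_pMr ?pi_gt0// ltr_pdivrMr ?ltr0n// mul1r ltr_nat.
rewrite /vertex E; move: s0; set t := pi * _ => s0.
apply/eqP => /(congr1 (@complex.Re R)) /=; have := cos2Dsin2 t.
move: s0; move: (sin t) (cos t) => x y; nra.
Qed.

Lemma vertex_mod n k : vertex R n (k %% n) = vertex R n k.
Proof.
have [->|n0] := posnP n; first by rewrite modn0.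
rewrite [in RHS](divn_eq k n) vertexD.
elim: (k %/ n)%N => [|q IH]; first by rewrite mul0n vertex0 mul1r.
by rewrite mulSn vertexD vertex_full// mul1r.
Qed.

Lemma vertex_eq n i j : (0 < n)%N ->
  vertex R n i = vertex R n j -> (i = j %[mod n])%N.
Proof.
move=> n0; rewrite -(vertex_mod n i) -(vertex_mod n j).
move: (ltn_pmod i n0) (ltn_pmod j n0); move: (_ %% _)%N (_ %% _)%N => x y.
wlog xy : x y / (x <= y)%N => [H xn yn E|xn yn].
  have [/H|/ltnW/H] := leqP x y; first exact.
  by move=> /(_ yn xn (esym E)) ->.
move=> E; have d1 : vertex R n (y - x) = 1.
  by apply: (mulIf (vertex_neq0 n x)); rewrite -vertexD subnK// mul1r.
have [d0|d0] := posnP (y - x)%N; first lia.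
by have /eqP[] : vertex R n (y - x) != 1 by apply: vertex_neq1; lia.
Qed.

End Vertices.

(** * Segments, lines and reflections as point sets and maps of the plane *)

Section Reflections.
Variable R : realType.
Implicit Types (p d z w : R[i]).

Lemma segment_sym z w : segment z w = segment w z.
Proof.
suff H (x y : R[i]) : segment x y `<=` segment y x.
  by apply/seteqP; split; apply: H.
move=> _ [t /= t01 <-]; exists (1 - t) => /=; first by lra.
by rewrite subKr addrC.
Qed.

Lemma segment_left z w : segment z w z.
Proof. by exists 0; rewrite /= ?lexx ?ler01// subr0 mul1r mul0r addr0. Qed.

(* z is an extreme point of [segment z w]. *)
Lemma segment_end z w z' w' :
  z != w -> segment z w = segment z' w' -> z = z' \/ z = w'.
Proof.
move=> zw E.
have [s /= s01 zE] : segment z' w' z by rewrite -E; exact: segment_left.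
have [p /= p01 z'E] : segment z w z' by rewrite E; exact: segment_left.
have [q /= q01 w'E] : segment z w w'.
  by rewrite E segment_sym; exact: segment_left.
(* With [z'] and [w'] at parameters [p] and [q] between [z] and [w], the point [z] itself has
   parameter [(1 - s) * p + s * q], which must vanish; both terms are nonnegative, so each is 0. *)
have /eqP : ((1 - s) * p + s * q)%:C * (w - z) = 0.
  rewrite -[RHS](subrr z) -{2}zE -z'E -w'E.
  by rewrite !(rmorphD, rmorphB, rmorphM, rmorph1) /=; ring.
rewrite mulf_eq0 subr_eq0 [w == z]eq_sym (negPf zw) orbF => /eqP [e0].
have /eqP : (1 - s) * p = 0 by nra.
rewrite mulf_eq0 => /orP[/eqP s1|/eqP p0].
  by right; rewrite -zE s1; rewrite (_ : s = 1) ?mul0r ?add0r ?mul1r//; lra.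
by left; rewrite -z'E p0 subr0 mul1r mul0r addr0.
Qed.

(** This turns equalities of point sets into equalities of vertices, hence into congruences modulo
    [n]. *)
Lemma segment_inj z w z' w' : z != w -> segment z w = segment z' w' ->
  (z = z' /\ w = w') \/ (z = w' /\ w = z').
Proof.
move=> zw E; have [zz|zz] := segment_end zw E.
  have := E; rewrite segment_sym => /segment_end -[|wz|ww]; rewrite 1?eq_sym//.
    by rewrite zz wz eqxx in zw.
  by left.
have := E; rewrite segment_sym => /segment_end -[|wz|ww]; rewrite 1?eq_sym//.
  by right.
by rewrite zz ww eqxx in zw.
Qed.

Lemma reflection_segment p d z w :
  reflection p d @` segment z w = segment (reflection p d z) (reflection p d w).
Proof.
have H t : reflection p d ((1 - t)%:C * z + t%:C * w) =
    (1 - t)%:C * reflection p d z + t%:C * reflection p d w.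
  rewrite /reflection !(rmorphB, rmorphD, rmorphM, rmorph1) /= !conj_realC.
  by ring.
apply/seteqP; split => [_ [_ [t /= t01 <-] <-]|_ [t /= t01 <-]].
  by exists t => //; rewrite H.
by exists ((1 - t)%:C * z + t%:C * w); rewrite ?H//; exists t.
Qed.

Lemma reflectionK p d : d != 0 -> involutive (reflection p d).
Proof.
move=> d0 z; have d0' : Num.conj d != 0 by rewrite conjC_eq0.
rewrite /reflection addrAC subrr add0r rmorphM fmorph_div /= !conjCK.
by field; rewrite d0 d0'.
Qed.

(** Axes can thus be compared and counted through the reflections they define. *)
Lemma line_fixed p d : d != 0 -> line p d = [set z | reflection p d z = z].
Proof.
move=> d0; have d0' : Num.conj d != 0 by rewrite conjC_eq0.
apply/seteqP; split => [_ [t _ <-]|z /= zE].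
  by rewrite /= /reflection addrAC subrr add0r rmorphM /= conj_realC; field.
(* Being fixed means that [(z - p) / d] is its own conjugate. *)
have [t tE] : exists t : R, (z - p) / d = t%:C.
  apply: conj_fixed_real; rewrite fmorph_div.
  by rewrite -{2}zE /reflection; field; rewrite d0 d0'.
by exists t => //; rewrite -tE divfK// subrKC.
Qed.

End Reflections.

(** * Parity along the alternating polygon, and its symmetry axes *)

Lemma odd_eqmod n x y : ~~ odd n -> (x = y %[mod n])%N -> odd x = odd y.
Proof. by move=> even_n /(congr1 odd); rewrite !odd_mod ?(negPf even_n). Qed.

Section AlternatingPolygon.
Variables (R : realType) (n a b : nat) (s : 'S_n).
Hypotheses (even_n : ~~ odd n) (n_gt3 : (3 < n)%N).
Hypotheses (a_gt0 : (0 < a)%N) (lt_ab : (a < b)%N) (lt_bn : (b < n)%N).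
Hypotheses (odd_a : odd a) (odd_b : odd b).
Hypothesis rep : represents (alternating_sides n a b) s.

Let side (i : nat) := if odd i then b else a.
Let V := vertex R n.

Lemma represents_mod (i : 'I_n) : (s i + side i = s (ordS i) %[mod n])%N.
Proof. by have := rep.2 i; rewrite tnth_mktuple. Qed.

Lemma represents_vertex (i : 'I_n) : V (s (ordS i)) = V (s i) * V (side i).
Proof. by rewrite -vertexD -[LHS]vertex_mod -represents_mod vertex_mod. Qed.

(** Each move is odd and [n] is even, so every move flips the parity. *)
Lemma represents_parity : exists c, forall i, odd (s i) = c (+) odd i.
Proof.
have n0 : (0 < n)%N by lia.
exists (odd (s (Ordinal n0))); case=> k; elim: k => [|k IH] hk /=.
  by rewrite addbF; congr (odd (s _)); apply: val_inj.
have hk' : (k < n)%N by lia.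
have -> : Ordinal hk = ordS (Ordinal hk').
  by apply: val_inj; rewrite /= modn_small.
rewrite -(odd_eqmod even_n (represents_mod _)) oddD IH /= /side.
by case: (odd k); rewrite ?odd_a ?odd_b -addbA.
Qed.

Lemma vertex_onto x : exists k, V x = V (s k) /\ odd x = odd (s k).
Proof.
have n0 : (0 < n)%N by lia.
exists ((s^-1)%g (Ordinal (ltn_pmod x n0))); rewrite permKV /= /V vertex_mod.
by split=> //; apply: (odd_eqmod even_n); rewrite modn_mod.
Qed.

(** For odd [t], the residue [t - s (ordS i)] has the parity of [s i], so the side leaving it has
    the same length as side [i]; it ends at [t - s i]. *)
Lemma reflected_side t (i : 'I_n) : odd t -> exists k,
  V t / V (s i) = V (s (ordS k)) /\ V t / V (s (ordS i)) = V (s k).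
Proof.
move=> ot; have [c par] := represents_parity.
have Ls : (s (ordS i) <= n)%N by apply: ltnW.
(* Adding [n - s (ordS i)] subtracts [s (ordS i)] modulo [n] without truncation. *)
have [k [Vk ok]] := vertex_onto (t + (n - s (ordS i))).
have V0 x : V x != 0 by apply: vertex_neq0.
have Ek : V t / V (s (ordS i)) = V (s k).
  apply: (mulIf (V0 (s (ordS i)))); rewrite divfK// -Vk -vertexD -addnA subnK//.
  by rewrite /V vertexD vertex_full ?mulr1//; lia.
have side_ki : side k = side i.
  rewrite /side; suff -> : odd k = odd i by [].
  apply: (@addbI c); rewrite -!par -ok oddD oddB// ot (negPf even_n) /=.
  rewrite -(odd_eqmod even_n (represents_mod i)) oddD /side.
  by case: (odd i); rewrite ?odd_a ?odd_b; case: (odd (s i)).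
exists k; split=> //; rewrite represents_vertex -Ek side_ki represents_vertex.
by field; rewrite !V0.
Qed.

Lemma reflection_odd t :
  (forall i, exists k,
     (V t / V (s i) = V (s k) /\ V t / V (s (ordS i)) = V (s (ordS k))) \/
     (V t / V (s i) = V (s (ordS k)) /\ V t / V (s (ordS i)) = V (s k))) ->
  odd t.
Proof.
move=> H; apply/negP => /negP/negPf ot; have [c par] := represents_parity.
have n0 : (0 < n)%N by lia.
have V0 x : V x != 0 by apply: vertex_neq0.
have side_sq i : V (side i + side i) = 1.
  (* Lengths depend only on the parity of the index, so [odd i], read as 0 or 1, can replace [i]. *)
  have hi : (odd i < n)%N by case: odd => /=; lia.
  have -> : side i = side (Ordinal hi) by rewrite /side /=; case: odd.
  move: (Ordinal hi) => {hi} {}i.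
  have [k [[E1 E2]|[E1 E2]]] := H i; move: (E2); rewrite !represents_vertex.
    (* Orientation kept: [s i + s k] is even, so both sides have the same length; as [x |-> t - x]
       negates moves, this length is its own opposite modulo [n]. *)
    have tE : V t = V (s i) * V (s k) by rewrite -E1; field.
    have /(odd_eqmod even_n) : (t = s i + s k %[mod n])%N.
      by apply: (@vertex_eq R) => //; rewrite vertexD.
    rewrite ot oddD !par => ik; have -> : side k = side i.
      by rewrite /side; move: ik; case: odd; case: odd; case: c {par}.
    rewrite tE => E; rewrite /V vertexD -/V.
    apply: (mulfI (V0 (s k))); rewrite mulr1 mulrA -E.
    by field; rewrite !V0.
  (* Orientation reversed: [s k] has the parity of [s (ordS i)], so one side has length [a] and the
     other [b], although the two must agree modulo [n]. *)
  have tE : V t = V (s (ordS i)) * V (s k) by rewrite -E2; field.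
  have /(odd_eqmod even_n) : (t = s (ordS i) + s k %[mod n])%N.
    by apply: (@vertex_eq R) => //; rewrite vertexD.
  rewrite ot oddD -(odd_eqmod even_n (represents_mod i)) oddD !par => ik _.
  have ik' : odd k = ~~ odd i.
    move: ik; rewrite /side.
    by case: (odd i); case: (odd k); rewrite ?odd_a ?odd_b; case: c {par}.
  have /(@vertex_eq R _ _ _ n0) : V (side i) = V (side k).
    apply: (mulfI (V0 (s i))); apply: (mulIf (V0 (s k))).
    rewrite -represents_vertex -tE -[RHS]mulrA [V (side k) * _]mulrC.
    by rewrite -represents_vertex -E1 mulrC divfK.
  by rewrite /side ik'; case: odd => /=; rewrite !modn_small; lia.
have double x : V (x + x) = V 0 -> (n %| x + x)%N.
  by move=> /(@vertex_eq R _ _ _ n0); rewrite mod0n /dvdn => ->.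
have /double : V (a + a) = V 0 by rewrite [RHS]vertex0; exact: (side_sq 0%N).
have /double : V (b + b) = V 0 by rewrite [RHS]vertex0; exact: (side_sq 1%N).
(* Since [a] and [b] lie strictly between 0 and [n], both doubles would equal [n], against
   [a < b]. *)
by move=> /dvdnP[[|[|x]] Ex] /dvdnP[[|[|y]] Ey]; nia.
Qed.

Lemma reflection_segments t d : odd t -> d != 0 -> d / Num.conj d = V t ->
  [set reflection 0 d @` S | S in polygon_segments s] = polygon_segments s.
Proof.
move=> ot d0 dE.
have rV x : reflection 0 d (V x) = V t / V x.
  by rewrite /reflection add0r subr0 dE conj_vertex.
have sub S : polygon_segments s S -> polygon_segments s (reflection 0 d @` S).
  move=> [i _ <-]; have [k [E1 E2]] := reflected_side i ot.
  by exists k; rewrite // reflection_segment !rV E1 E2 segment_sym.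
(* The reflection is an involution, so [sub] yields both inclusions. *)
apply/seteqP; split=> [_ [S /sub ? <-]//|S /sub rS].
exists (reflection 0 d @` S) => //.
by rewrite image_comp (_ : _ \o _ = id) ?image_id//; apply/funext/reflectionK.
Qed.

Lemma axis_direction p d : d != 0 ->
  [set reflection p d @` S | S in polygon_segments s] = polygon_segments s ->
  exists2 t, odd t & reflection p d = fun z => V t * Num.conj z.
Proof.
move=> d0 axis; have n0 : (0 < n)%N by lia.
have V0 x : V x != 0 by apply: vertex_neq0.
have rinj := inv_inj (reflectionK p d0); set r := reflection p d in axis rinj *.
have sides i : exists k,
    (r (V (s i)) = V (s k) /\ r (V (s (ordS i))) = V (s (ordS k))) \/
    (r (V (s i)) = V (s (ordS k)) /\ r (V (s (ordS i))) = V (s k)).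
  have : polygon_segments s (r @` segment (V (s i)) (V (s (ordS i)))).
    rewrite -axis; exists (segment (V (s i)) (V (s (ordS i)))) => //.
    by exists i.
  case=> k _; rewrite reflection_segment => /esym/segment_inj E.
  (* The endpoints stay distinct: [r] is injective and consecutive vertices have opposite
     parities. *)
  exists k; apply: E; apply/eqP => /rinj /(@vertex_eq R _ _ _ n0).
  move/(odd_eqmod even_n).
  rewrite -(odd_eqmod even_n (represents_mod i)) oddD /side.
  by case: (odd i); rewrite ?odd_a ?odd_b; case: (odd (s i)).
have vert x : exists y, r (V x) = V y.
  have [i [-> _]] := vertex_onto x.
  by have [k [[-> _]|[-> _]]] := sides i; [exists (s k)|exists (s (ordS k))].
pose u := d / Num.conj d.
have [q rE] : exists q, forall z, r z = q + u * Num.conj z.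
  exists (p - u * Num.conj p) => z.
  by rewrite /r /reflection rmorphB /= -/u; ring.
(* The antipodal vertices 1 and -1 are sent to [q + u] and [q - u], which must again be vertices. *)
have Vhalf : V (n./2) = -1.
  rewrite /V; have -> : vertex R n = vertex R (2 * n./2) by congr vertex; lia.
  by apply: vertex_half; lia.
have [t tE] := vert 0%N; have [t' tE'] := vert n./2.
move: tE tE'; rewrite Vhalf [V 0]vertex0 !rE rmorphN !rmorph1 mulrN !mulr1.
move=> tE tE'.
have uu : u * Num.conj u = 1.
  have d0' : Num.conj d != 0 by rewrite conjC_eq0.
  by rewrite /u fmorph_div /= conjCK; field; rewrite d0.
(* q + u, q - u and u are on the unit circle: parallelogram law. *)
have q0 : q = 0.
  have := vertex_unit R n t; have := vertex_unit R n t'.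
  rewrite -/V -tE -tE' rmorphB rmorphD /= => A B.
  have /eqP : q * Num.conj q *+ 2 = 0.
    have -> : q * Num.conj q *+ 2 =
      (q - u) * (Num.conj q - Num.conj u) + (q + u) * (Num.conj q + Num.conj u)
      - (u * Num.conj u) *+ 2 by ring.
    by rewrite A B uu; ring.
  by rewrite mulrn_eq0 /= mulf_eq0 conjC_eq0 orbb => /eqP.
move: tE; rewrite q0 add0r => uE.
have rt : r = fun z => V t * Num.conj z.
  by apply/funext => z; rewrite rE q0 add0r uE.
exists t => //; apply: reflection_odd => i; have := sides i.
by rewrite rt -!conj_vertex.
Qed.

Lemma axesE : polygon_axes s =
  [set [set z | V j.*2.+1 * Num.conj z = z] | j in `I_n./2].
Proof.
have n0 : (0 < n)%N by lia.
apply/seteqP; split => [L [p [d [d0 -> /(axis_direction d0) [t ot rE]]]]|].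
  have tn := ltn_pmod t n0; exists ((t %% n)./2); rewrite /=; first by lia.
  have -> : ((t %% n)./2.*2.+1 = t %% n)%N.
    have : odd (t %% n) by rewrite (@odd_eqmod n _ t)// modn_mod.
    lia.
  by rewrite line_fixed// rE /V vertex_mod.
(* A square root of [V j.*2.+1] on the unit circle: there [d / Num.conj d] is the square of [d]. *)
move=> _ [j /= jn <-]; pose d := vertex R (2 * n) j.*2.+1.
have d0 : d != 0 by apply: vertex_neq0.
have dE : d / Num.conj d = V j.*2.+1 by rewrite conj_vertex invrK vertex_double.
exists 0, d; split => //.
  rewrite line_fixed// /reflection dE; apply/seteqP.
  by split=> z /=; rewrite add0r subr0.
by apply: (reflection_segments _ d0 dE); rewrite /= odd_double.
Qed.

Lemma alternating_axes : polygon_with_axes R s n./2.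
Proof.
rewrite /polygon_with_axes axesE; apply: inj_card_eq => i j.
rewrite !inE /= => iN jN E.
(* A nonzero point of axis [i]; if it also lies on axis [j], cancelling [Num.conj d] identifies the
   two odd residues, both below [n]. *)
pose d := vertex R (2 * n) i.*2.+1.
have d0 : d != 0 by apply: vertex_neq0.
have dE : d = V i.*2.+1 * Num.conj d.
  by rewrite /V -[vertex R n _]vertex_double -/d conj_vertex mulfK.
have : [set z | V i.*2.+1 * Num.conj z = z] d by [].
have n0 : (0 < n)%N by lia.
have conj_d0 : Num.conj d != 0 by rewrite conjC_eq0.
rewrite E /= {2}dE => /(mulIf conj_d0)/(vertex_eq n0).
rewrite !modn_small; lia.
Qed.

End AlternatingPolygon.

(** * Existence of the polygon *)

Lemma alternating_polygon_exists n a b : ~~ odd n -> (0 < n)%N ->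
  (1 <= a <= n.-1)%N -> (1 <= b <= n.-1)%N -> odd a -> odd b ->
  gcdn (a + b) n = 2 -> exists s : 'S_n, represents (alternating_sides n a b) s.
Proof.
move=> en n0 ha hb oa ob g.
(* The sum of the first [i] sides modulo [n], that is, the vertex reached from vertex 0. Its parity
   is that of [i], so only indices of equal parity can collide. *)
pose f (i : 'I_n) := Ordinal (ltn_pmod (i./2 * (a + b) + odd i * a) n0).
have finj : injective f.
  move=> i j /(congr1 val) /= E.
  have oij : odd i = odd j.
    have := odd_eqmod en E; rewrite !oddD !oddM !oddD oa ob /= !andbF /=.
    by rewrite !andbT !oddb.
  move: E; rewrite oij => /eqP; rewrite eqn_modDr => /eqP E.
  apply: val_inj => /=; move: E.
  wlog ij : i j oij / (i <= j)%N => [H E|].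
    have [/H|/ltnW/H] := leqP i j; first exact.
    by move=> /(_ (esym oij) (esym E)).
  move/esym/eqP; rewrite eqn_mod_dvd ?leq_mul2r ?half_leq ?orbT// -mulnBl.
  have [c cE] : exists c, (a + b = 2 * c)%N by exists (a + b)./2; lia.
  have nE : (n = 2 * n./2)%N by lia.
  (* After halving, [n./2] is coprime to [c], so it divides [j./2 - i./2], which is smaller than
     [n./2]. *)
  rewrite cE [X in (X %| _)%N]nE mulnCA dvdn_pmul2l// Gauss_dvdl; last first.
    rewrite coprime_sym /coprime -(eqn_pmul2l (ltn0Sn 1)).
    by rewrite muln_gcdr -cE -nE g.
  move=> /dvdnP[[|x]]; first by lia.
  by have := ltn_ord j; nia.
exists (perm finj); split => i; rewrite tnth_mktuple; first by case: odd.
rewrite !permE /= modnDml.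
have lt_in := ltn_ord i; have [iN|iN] := ltnP i.+1 n.
  rewrite (modn_small iN) modn_mod; congr (_ %% _)%N.
  rewrite /= uphalf_half; case: (odd i) => /=; lia.
(* The closing side: the sum of all sides is [n./2 * (a + b)], a multiple of [n] because [a + b] is
   even. *)
have {iN} iN : (i.+1 = n)%N by lia.
have oi : odd i by lia.
rewrite iN modnn mod0n oi /=.
have nE : (i./2.+1 * 2 = n)%N by lia.
have cE : ((a + b)./2 * 2 = a + b)%N by lia.
have -> : (i./2 * (a + b) + 1 * a + b = (a + b)./2 * n)%N.
  by rewrite -[in RHS]nE mulnCA cE; lia.
by rewrite modnMl mod0n.
Qed.

(** The sides fix the ordering only up to its starting vertex, so the axes are counted for every
    such [s]; existence keeps this count from being vacuous. *)
Theorem theorem6 (R : realType) (n m a b : nat)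
  (hn : n = (2 * m)%N) (hn3 : (3 < n)%N)
  (ha : (1 <= a)%N) (hab : (a < b)%N) (hb : (b <= n - 1)%N)
  (oa : odd a) (ob : odd b) (hgcd : gcdn (a + b) n = 2%N) :
  (exists s : 'S_n, represents (alternating_sides n a b) s) /\
  (forall s : 'S_n, represents (alternating_sides n a b) s ->
     polygon_with_axes R s m).
Proof.
have en : ~~ odd n by lia.
split=> [|s rep]; first by apply: alternating_polygon_exists => //; lia.
have -> : m = n./2 by lia.
by apply: alternating_axes rep => //; lia.
Qed.
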